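(* Let $F \hookrightarrow E \xrightarrow{p} B$ be a fibre bundle with structure group $G$ such that $E^k$ is a completely normal space. Let $\{U_1,\dots,U_m\}$ be an open cover of $B^k$ with sequential motion planners $s_i\colon U_i\to B^I$. Suppose there exists a closed cover $\{R_1,\dots,R_m\}$ of $B$ with local trivializations $f_i\colon p^{-1}(R_i)\to R_i\times F$ of $F \hookrightarrow E \xrightarrow{p} B$ such that the $f_i$ form a $G$-atlas of $F \hookrightarrow E \xrightarrow{p} B$ and $s_i(U_i)\subseteq R_i^I$ for every $i$. Then $$\mathrm{TC}_k(E)\le m+\mathrm{TC}_{k,G}^{\#,*}(F)-1 .$$ In particular, $\mathrm{TC}_k(E)\le m+\mathrm{cat}_{G^k}^{\#}(F^k)-1$ and $\mathrm{TC}_k(E)\le m+\mathrm{TC}_{k,G}^{*}(F)-1$.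
   Context: $I=[0,1]$; $X^I$ is the space of continuous paths $I\to X$ with the compact-open topology; for $R\subseteq B$, $R^I\subseteq B^I$ is the set of paths with image in $R$. For an integer $k\ge2$ let $e_{k,X}\colon X^I\to X^k$, $e_{k,X}(\alpha)=\left(\alpha(0),\alpha(\tfrac1{k-1}),\dots,\alpha(\tfrac{k-2}{k-1}),\alpha(1)\right)$. A sequential motion planner over $U\subseteq X^k$ is a continuous map $s\colon U\to X^I$ with $e_{k,X}\circ s$ equal to the inclusion $U\hookrightarrow X^k$. $\mathrm{TC}_k(X)$ is the smallest $n$ such that $X^k$ has an open cover by $n$ sets each admitting a sequential motion planner. Let $X$ be a $G$-space; $G^k$ acts on $X^k$ componentwise. $\mathrm{TC}_{k,G}^{\#,*}(X)$ is the smallest $n$ such that $X^k$ has an open cover by $n$ $G^k$-invariant sets, each admitting a (not necessarily equivariant) sequential motion planner. $\mathrm{TC}_{k,G}^{*}(X)$ is defined in the same way, but requiring the motion planners $s_i\colon U_i\to X^I$ to be $G$-maps, where $G$ acts diagonally on $U_i\subseteq X^k$ and on $X^I$ by $(g\alpha)(t)=g(\alpha(t))$. For a $\Gamma$-space $Y$, $\mathrm{cat}_\Gamma^{\#}(Y)$ is the smallest $n$ such that $Y$ has an open cover by $n$ $\Gamma$-invariant sets whose inclusions into $Y$ are null-homotopic (non-equivariantly). Each invariant is $\infty$ if no such $n$ exists. The structure group $G$ acts on $F$. A local trivialization over a (not necessarily open) subset $R\subseteq B$ is a homeomorphism $p^{-1}(R)\to R\times F$ over $R$. The $f_i$ form a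 $G$-atlas if there are continuous maps $t_{ii'}\colon R_i\cap R_{i'}\to G$ with $(f_i\circ f_{i'}^{-1})(x,y)=(x,t_{ii'}(x)y)$ on $(R_i\cap R_{i'})\times F$.
   Formalization: The inequality with cat_{G^k}^#(F^k) is proved for path-connected F only; without this it fails, e.g. for k=2, B a point, m=1, G trivial and E=F two discrete points, where cat^#(F^2)=4 but TC_2(E)=∞. *)

(* Defs.v *)
From HB Require Import structures.
From mathcomp Require Import all_boot all_order all_algebra.
From mathcomp Require Import all_classical all_reals ereal topology normedtype.

Set Implicit Arguments.
Unset Strict Implicit.
Unset Printing Implicit Defensive.

Import Order.TTheory GRing.Theory Num.Theory.
Import numFieldNormedType.Exports.

Local Open Scope classical_set_scope.
Local Open Scope ring_scope.

(* Conventions.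
   - A map defined on a subset A of X is encoded as a total function on X whose
     restriction to A is continuous ({within A, continuous f}); its values
     outside A are irrelevant.
   - Products X^k are indexed by 'I_k. *)

HB.mixin Record isTopologicalGroup G & Topological G & Group G := {
  mulg_continuous : continuous (fun x : G * G => (x.1 * x.2)%g);
  invg_continuous : continuous (fun x : G => (x^-1)%g)
}.

#[short(type="topologicalGroupType")]
HB.structure Definition TopologicalGroup :=
  {G of Topological G & Group G & isTopologicalGroup G}.

Definition unit_interval (R : realType) : topologicalType :=
  set_type (`[0, 1]%classic : set R).

Section unit_interval_points.
Context (R : realType).

Lemma node_subproof (k : nat) (i : 'I_k) :
  (i%:R / k.-1%:R : R) \in (`[0, 1]%classic : set R).
Proof.
apply/mem_set; rewrite /= in_itv /= divr_ge0//=.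
have ik : (i <= k.-1)%N by case: k i => [[]//|k i]; rewrite -ltnS.
case: (posnP k.-1) => [->|k0]; first by rewrite invr0 mulr0.
by rewrite ler_pdivrMr ?ltr0n// mul1r ler_nat.
Qed.

Lemma unit0_subproof : (0 : R) \in (`[0, 1]%classic : set R).
Proof. by apply/mem_set; rewrite /= in_itv /= lexx ler01. Qed.

Lemma unit1_subproof : (1 : R) \in (`[0, 1]%classic : set R).
Proof. by apply/mem_set; rewrite /= in_itv /= lexx ler01. Qed.

Definition node (k : nat) (i : 'I_k) : unit_interval R :=
  exist _ (i%:R / k.-1%:R) (node_subproof i).

Definition unit0 : unit_interval R := exist _ 0 unit0_subproof.
Definition unit1 : unit_interval R := exist _ 1 unit1_subproof.

End unit_interval_points.
Arguments node R {k} i.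
Arguments unit0 {R}.
Arguments unit1 {R}.

(* X^I, with the topology induced by the compact-open one *)
Definition path_space (R : realType) (X : topologicalType) : Type :=
  continuousType (unit_interval R) X.

HB.instance Definition _ (R : realType) (X : topologicalType) :=
  gen_eqMixin (path_space R X).
HB.instance Definition _ (R : realType) (X : topologicalType) :=
  gen_choiceMixin (path_space R X).

HB.instance Definition _ (R : realType) (X : topologicalType) :=
  Topological.copy (path_space R X)
    (@initial_topology (path_space R X) {compact-open, unit_interval R -> X}
      (fun a => a : unit_interval R -> X)).

Definition power (k : nat) (X : topologicalType) : topologicalType :=
  prod_topology (fun _ : 'I_k => X).

Section topology_notions.
Context (R : realType).

Definition path_connected (X : topologicalType) :=
  forall x y : X, exists a : path_space R X, a unit0 = x /\ a unit1 = y.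

(* No T1 or Hausdorff axiom is part of this notion. *)
Definition completely_normal (X : topologicalType) :=
  forall A B : set X, separated A B ->
    exists V W : set X,
      [/\ open V, open W, A `<=` V, B `<=` W & V `&` W = set0].

Definition null_homotopic_incl (Y : topologicalType) (U : set Y) :=
  exists (H : Y * unit_interval R -> Y) (c : Y),
    {within U `*` setT, continuous H} /\
    forall y, U y -> H (y, unit0) = y /\ H (y, unit1) = c.

(* The least n such that Y has an open cover by n sets satisfying P, and +oo if
   there is none: the infimum of a nonempty set of natural numbers is its
   minimum, and ereal_inf set0 = +oo. *)
Definition open_cover_number (Y : topologicalType) (P : set Y -> Prop)
    : \bar R :=
  ereal_inf [set n%:R%:E | n in [set n : nat |
    exists U : 'I_n -> set Y,
      [/\ forall i, open (U i), \bigcup_i U i = setT & forall i, P (U i)]]].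

End topology_notions.

Section actions.
Context (G : topologicalGroupType) (X : topologicalType).

Record continuous_action (act : G -> X -> X) : Prop := {
  act_one : forall x, act 1%g x = x;
  act_mul : forall g h x, act (g * h)%g x = act g (act h x);
  act_continuous : continuous (fun gx : G * X => act gx.1 gx.2)
}.

(* G^k is the type {ffun 'I_k -> G}, which carries the product group structure;
   its topology plays no role in the invariants below. *)
Definition power_act (k : nat) (act : G -> X -> X)
    (g : {ffun 'I_k -> G}) (x : power k X) : power k X :=
  fun i => act (g i) (x i).

Definition diagonal_act (k : nat) (act : G -> X -> X)
    (g : G) (x : power k X) : power k X :=
  fun i => act g (x i).

End actions.

Definition invariant_set (Gamma : groupType) (Y : Type)
    (act : Gamma -> Y -> Y) (U : set Y) :=
  forall g y, U y -> U (act g y).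

Section invariants.
Context (R : realType).

Definition path_eval (k : nat) (X : topologicalType) (a : path_space R X)
  : power k X := fun i => a (node R i).

Definition motion_planner (k : nat) (X : topologicalType)
    (U : set (power k X)) (s : power k X -> path_space R X) :=
  {within U, continuous s} /\ forall x, U x -> path_eval (s x) = x.

Definition TC (k : nat) (X : topologicalType) : \bar R :=
  @open_cover_number R (power k X) (fun U => exists s, motion_planner U s).

Definition TC_sharp_star (k : nat) (G : topologicalGroupType)
    (X : topologicalType) (act : G -> X -> X) : \bar R :=
  @open_cover_number R (power k X) (fun U =>
    invariant_set (@power_act G X k act) U /\ exists s, motion_planner U s).

Definition equivariant_planner (k : nat) (G : topologicalGroupType)
    (X : topologicalType) (act : G -> X -> X)
    (U : set (power k X)) (s : power k X -> path_space R X) :=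
  forall g x, U x ->
    forall t, s (diagonal_act act g x) t = act g (s x t).

Definition TC_star (k : nat) (G : topologicalGroupType)
    (X : topologicalType) (act : G -> X -> X) : \bar R :=
  @open_cover_number R (power k X) (fun U =>
    invariant_set (@power_act G X k act) U /\
    exists s, motion_planner U s /\ equivariant_planner act U s).

Definition cat_sharp (Gamma : groupType) (Y : topologicalType)
    (act : Gamma -> Y -> Y) : \bar R :=
  @open_cover_number R Y (fun U =>
    invariant_set act U /\ null_homotopic_incl R U).

End invariants.

Section bundles.
Context (G : topologicalGroupType) (E B F : topologicalType).
Context (act : G -> F -> F) (p : E -> B).

(* a homeomorphism p^-1(A) -> A x F over A, together with its inverse *)
Record local_trivialization (A : set B) := {
  triv : E -> B * F;
  triv_inv : B * F -> E;
  triv_continuous : {within p @^-1` A, continuous triv};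
  triv_inv_continuous : {within A `*` setT, continuous triv_inv};
  triv_over : forall e, A (p e) -> (triv e).1 = p e;
  triv_inv_over : forall z, A z.1 -> p (triv_inv z) = z.1;
  trivK : forall e, A (p e) -> triv_inv (triv e) = e;
  triv_invK : forall z, A z.1 -> triv (triv_inv z) = z
}.

Definition G_atlas (J : Type) (A : J -> set B)
    (f : forall j, local_trivialization (A j)) :=
  exists t : J -> J -> B -> G, forall i j,
    {within A i `&` A j, continuous (t i j)} /\
    forall x y, (A i `&` A j) x ->
      triv (f i) (triv_inv (f j) (x, y)) = (x, act (t i j x) y).

Definition fibre_bundle :=
  continuous p /\
  exists (J : Type) (O : J -> set B) (h : forall j, local_trivialization (O j)),
    [/\ forall j, open (O j), \bigcup_j O j = setT & G_atlas h].

End bundles.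
Arguments local_trivialization {E B} F p A.

(* Main.v *)
Require Import Defs.
From HB Require Import structures.
From mathcomp Require Import all_boot all_order all_algebra.
From mathcomp Require Import all_classical all_reals ereal topology normedtype.
From mathcomp Require Import lra.
Local Open Scope classical_set_scope.
Local Open Scope ring_scope.

Import Order.TTheory GRing.Theory Num.Theory.
Import numFieldNormedType.Exports.

(** Write [P i] for the set of [k]-tuples of [E] whose projection lies in
    [U i]. As [s i] moves inside [C i], the set [U i] is contained in [C i ^ k],
    so [f i] gives every tuple in [P i] a fibre coordinate in [F^k]. Let [V j]
    be an open cover of [F^k] by [n] sets that are invariant under [G^k] and
    carry motion planners, and let [Q i j] be the part of [P i] with fibre
    coordinate in [V j]. A motion planner on [Q i j] runs [s i] in the base and
    the planner of [V j] in the fibre, and returns to [E] through the inverse of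
    [f i] (trivialized_motion_planner).

    The [m * n] sets [Q i j] have to be regrouped into [m + n - 1]. Let the
    stratum [Z i j] consist of the tuples for which [i] is the first index with
    [P i], and then [j] the first index with [Q i j]. Two trivializations differ
    by elements of [G], one for each entry of the tuple, and [V j] is invariant
    under all of [G^k]; hence on the overlap of [P i] and [P i'] the sets
    [Q i j] and [Q i' j] agree. Consequently two strata with the same [i + j]
    are separated: if [i < i'], then [j' < j], the open set [P i] contains [Z i j]
    and misses [Z i' j'], while the open set [Q i' j'] contains [Z i' j'] and
    misses [Z i j] (separated_strata). Complete normality surrounds the strata
    of one level [i + j = l] by disjoint open sets, inside the [Q i j], and
    planners on disjoint open sets combine into one (motion_planner_bigcup).
    The levels are [0, ..., m + n - 2], so [m + n - 1] open sets suffice.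

    The two other bounds compare the invariants of [F]. A set of the cover in
    [TC_star] is in particular one in [TC_sharp_star]. If a subset of [F^k]
    contracts in [F^k] and [F] is path connected, the contraction can be
    prolonged so that all [k] coordinates end at one point [x0]; the planner
    then goes from each entry of the tuple to [x0] and from there back along the
    contraction of the next entry (null_homotopic_motion_planner).

    Planners are constructed as continuous maps of two variables, a tuple and a
    time; passing to the adjoint map and back preserves continuity because the
    unit interval is compact and regular (path_space_continuousP). *)

(** * Continuity of restrictions, products and powers *)

Lemma within_comp {T X Y : topologicalType} (A : set X) {g : T -> X}
    {f : X -> Y} :
  continuous g -> (forall t, A (g t)) -> {within A, continuous f} ->
  continuous (f \o g).
Proof.
move=> cg gA /subspace_continuousP cf t; apply: cvg_comp (cf _ (gA t)).
move=> S AS; have gS : nbhs t (g @^-1` [set x | A x -> S x]) by exact: cg.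
by apply: filterS gS => z; apply; exact: gA.
Qed.

Lemma continuous_pair (T X Y : topologicalType) (f : T -> X) (g : T -> Y) :
  continuous f -> continuous g -> continuous (fun t => (f t, g t)).
Proof. by move=> cf cg t; apply: cvg_pair; [exact: cf | exact: cg]. Qed.

Lemma continuous_fst {X Y : topologicalType} : continuous (@fst X Y).
Proof. by move=> [x y]; exact: cvg_fst. Qed.

Lemma continuous_snd {X Y : topologicalType} : continuous (@snd X Y).
Proof. by move=> [x y]; exact: cvg_snd. Qed.

Lemma continuous_val {X : topologicalType} {A : set X} :
  continuous (fun a : set_type A => \val a).
Proof. exact: initial_continuous. Qed.

Lemma continuous_coord {k : nat} {X : topologicalType} (i : 'I_k) :
  continuous (fun x : power k X => x i).
Proof. exact: (@proj_continuous _ (fun _ : 'I_k => X)). Qed.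

Lemma continuous_power (k : nat) (T X : topologicalType) (f : T -> power k X) :
  (forall i, continuous (fun t => f t i)) -> continuous f.
Proof.
move=> cf t.
have fF : Filter (f @ nbhs t) by apply: fmap_filter; exact: nbhs_filter.
apply/cvg_sup => i.
exact: (@continuous_comp_initial _ _ _ (fun x : power k X => x i) f (cf i) t).
Qed.

(** Filters on the subtype are pushed forward along the inclusion, and a cluster
    point of the image is lifted back. *)
Lemma compact_set_type (X : topologicalType) (A : set X) :
  compact A -> compact [set: set_type A].
Proof.
move=> cptA Fs FF _.
have FA : (fmap (fun y : set_type A => \val y) Fs) A.
  by apply: (@filterE _ Fs) => y; exact: set_valP.
have [x [Ax clx]] := cptA _ (fmap_proper_filter _ FF) FA.
exists (exist _ x (mem_set Ax)); split => // S N FS [_ [[V oV <-] /= Vx VN]].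
have FvS : fmap (fun y : set_type A => \val y) Fs
    ((fun y : set_type A => \val y) @` S).
  by apply: (@filterS _ Fs _ S) FS => y Sy; exists y.
have [_ [[y Sy <-] Vy]] := clx _ V FvS (open_nbhs_nbhs (conj oV Vx)).
by exists y; split => //; exact: VN.
Qed.

(** * Path spaces and motion planners *)

Section paths.
Context {R : realType}.

Lemma unit_interval_compact : compact [set: unit_interval R].
Proof. exact/compact_set_type/segment_compact. Qed.

Lemma unit_interval_locally_compact : locally_compact [set: unit_interval R].
Proof.
move=> t _; exists setT; first by rewrite withinET; exact: filterT.
by split; [exact: unit_interval_compact|exact: closedT].
Qed.

Lemma unit_interval_regular : regular_space (unit_interval R).
Proof. exact: (@uniform_regular (set_type (`[0, 1]%classic : set R))). Qed.

(** The exponential law for [I]: currying preserves continuity for every space,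
    and uncurrying does so since [I] is locally compact and regular. *)
Lemma path_space_continuousP {T X : topologicalType} (s : T -> path_space R X) :
  continuous s <-> continuous (fun z : T * unit_interval R => s z.1 z.2).
Proof.
split=> [cs|cs].
  rewrite (_ : (fun _ => _) = uncurry (fun y => s y : unit_interval R -> X));
    last by apply/funext => -[].
  apply: (@continuous_uncurry_regular T (unit_interval R) X).
  - exact: unit_interval_locally_compact.
  - exact: unit_interval_regular.
  - move=> t; apply: (@continuous_comp T (path_space R X)
      {compact-open, unit_interval R -> X} s
      (fun a => a : unit_interval R -> X)); first exact: cs.
    exact: (@initial_continuous (path_space R X)
      {compact-open, unit_interval R -> X}).
  - by move=> u; exact: cts_fun.
apply: (@continuous_comp_initial (path_space R X) T
  {compact-open, unit_interval R -> X}
  (fun a => a : unit_interval R -> X) s).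
exact: (continuous_curry_fun cs : continuous
  (curry _ : T -> {compact-open, unit_interval R -> X})).
Qed.

Definition mk_path {X : topologicalType} {f : unit_interval R -> X}
    (cf : continuous f) : path_space R X :=
  HB.pack f (isContinuous.Build _ _ f cf).

Definition const_path {X : topologicalType} (x : X) : path_space R X :=
  mk_path (@cst_continuous _ _ x).

(** The form in which planners are produced below: a map of two variables that
    is defined on [W] only. Outside [W] the planner takes the constant path at
    the entry of index [0], which is why [k] has to be positive. *)
Lemma motion_plannerP {k : nat} {X : topologicalType} {W : set (power k X)}
    (h : set_type W * unit_interval R -> X) :
  (0 < k)%N -> continuous h -> (forall w i, h (w, node R i) = \val w i) ->
  exists s : power k X -> path_space R X, motion_planner W s.
Proof.
case: k W h => // k W h _ ch hnode.
have chw (w : set_type W) : continuous (fun t => h (w, t)).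
  move=> t; apply: (@continuous_comp _ _ _ (fun t => (w, t)) h); last exact: ch.
  by apply: continuous_pair; [exact: cst_continuous|move=> u].
pose s x := match pselect (W x) with
  | left Wx => mk_path (chw (exist _ x (mem_set Wx)))
  | right _ => const_path (x ord0) end.
have sE (w : set_type W) t : s (\val w) t = h (w, t).
  rewrite /s; case: pselect => [Wx|nWx]; last by case: nWx; exact: set_valP.
  by congr (h (_, t)); apply: val_inj.
exists s; split.
  apply/subspace_sigL_continuousP/path_space_continuousP.
  by rewrite (_ : (fun _ => _) = h)//; apply/funext => -[w t]; exact: sE.
move=> x Wx; apply/funext => i.
by have := sE (exist _ x (mem_set Wx)) (node R i); rewrite hnode.
Qed.

Lemma motion_plannerW {k : nat} {X : topologicalType} {A B : set (power k X)}
    {s : power k X -> path_space R X} :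
  A `<=` B -> motion_planner B s -> motion_planner A s.
Proof.
move=> AB [cs es]; split; first exact: continuous_subspaceW cs.
by move=> x /AB; exact: es.
Qed.

(** Continuity is local on a union of open sets, and near a point of [W a] the
    planner chosen for the union is the one of [W a], as no other member of the
    family contains that point. *)
Lemma motion_planner_bigcup (k : nat) (X : topologicalType) (T : Type)
    (D : set T) (W : T -> set (power k X)) :
  (0 < k)%N -> (forall a, D a -> open (W a)) -> trivIset D W ->
  (forall a, D a ->
    exists s : power k X -> path_space R X, motion_planner (W a) s) ->
  exists s : power k X -> path_space R X,
    motion_planner (\bigcup_(a in D) W a) s.
Proof.
case: k W => // k W _ oW tW pW.
have /choice [r rP] a : exists s : power k.+1 X -> path_space R X,
    D a -> motion_planner (W a) s.
  have [/pW [s sP]|nDa] := pselect (D a); first by exists s.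
  by exists (fun x => const_path (x ord0)).
pose s x := match pselect (exists a, D a /\ W a x) with
  | left ex => r (sval (cid ex)) x
  | right _ => const_path (x ord0) end.
have sE a x : D a -> W a x -> s x = r a x.
  move=> Da Wax; rewrite /s; case: pselect => [ex|]; last by case; exists a.
  by case: cid => b [Db Wbx] /=; rewrite (tW b a Db Da)//; exists x.
have oU : open (\bigcup_(a in D) W a) by exact: bigcup_open.
exists s; split; last first.
  by move=> x [a Da Wax]; rewrite (sE a)//; apply: (rP a Da).2.
rewrite continuous_open_subspace// => x /set_mem [a Da Wax].
have [+ _] := rP a Da; rewrite continuous_open_subspace; last exact: oW.
move=> /(_ x (mem_set Wax)) cr N; rewrite (sE a)// => /cr.
have : nbhs x (W a) by exact: open_nbhs_nbhs (conj (oW a Da) Wax).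
by apply: filterS2 => y Way; rewrite /= (sE a).
Qed.
End paths.

(** * Separation and pasting *)

Lemma finite_bigcap_open (T : finType) (X : topologicalType) (A : T -> set X) :
  (forall a, open (A a)) -> open (\bigcap_a A a).
Proof.
move=> oA; rewrite openE => x Ax.
have : \forall y \near x, forall a, A a y.
  apply: filter_forall => a; apply: open_nbhs_nbhs.
  by split; [exact: oA|exact: Ax].
by apply: filterS => y Ay a _; exact: Ay.
Qed.

Lemma separated_by_open (X : topologicalType) (A B V W : set X) :
  open V -> open W -> A `<=` V -> B `<=` W -> V `&` B = set0 ->
  W `&` A = set0 -> separated A B.
Proof.
have clos (C D O : set X) : open O -> D `<=` O -> O `&` C = set0 ->
    closure C `&` D = set0.
  move=> oO DO OC; apply/seteqP; split=> // x [clx Dx].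
  have [y [Cy Oy]] := clx O (open_nbhs_nbhs (conj oO (DO _ Dx))).
  by have : (O `&` C) y by []; rewrite OC.
move=> oV oW AV BW VB WA; split; first exact: clos oW BW WA.
by rewrite setIC; exact: clos oV AV VB.
Qed.

(** Complete normality for finitely many sets at once: [Z a] is surrounded by
    the intersection of the neighbourhoods that it receives from all the pairs
    in which it occurs, as first or as second member. The relation [r] selects
    the pairs to be separated, since strata of different levels need not be. *)
Lemma separated_family_open {T : finType} {X : topologicalType}
    (r : T -> T -> Prop) {Z : T -> set X} :
  completely_normal X -> (forall a b, r a b -> separated (Z a) (Z b)) ->
  exists O : T -> set X, [/\ forall a, open (O a), forall a, Z a `<=` O a &
    forall a b, r a b -> O a `&` O b = set0].
Proof.
move=> nX sZ.
have /choice [VW VWP] (ab : T * T) : exists VW : set X * set X,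
    [/\ open VW.1, open VW.2, Z ab.1 `<=` VW.1, Z ab.2 `<=` VW.2 &
      r ab.1 ab.2 -> VW.1 `&` VW.2 = set0].
  have [/sZ /nX [V [W [oV oW ZV ZW VW0]]]|nr] := pselect (r ab.1 ab.2).
    by exists (V, W).
  by exists (setT, setT); split => //; exact: openT.
exists (fun a => \bigcap_b ((VW (a, b)).1 `&` (VW (b, a)).2)); split.
- move=> a; apply: finite_bigcap_open => b; apply: openI.
    by have [] := VWP (a, b).
  by have [] := VWP (b, a).
- move=> a x Zx b _; split.
    by have [_ _ + _ _] := VWP (a, b); exact.
  by have [_ _ _ + _] := VWP (b, a); exact.
- move=> a b rab; apply/seteqP; split => // x [/(_ b I) [+ _] /(_ a I) [_ +]].
  have [_ _ _ _ /(_ rab) VW0] := VWP (a, b) => Vx Wx.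
  by rewrite -VW0.
Qed.

(** A finite union of closed sets is closed, so the preimages of closed sets can
    be tested piece by piece. *)
Lemma closed_pasting (T : finType) (X Y : topologicalType) (A : T -> set X)
    (g : T -> X -> Y) :
  (forall a, closed (A a)) -> (forall x, exists a, A a x) ->
  (forall a, continuous (g a)) ->
  (forall a b x, A a x -> A b x -> g a x = g b x) ->
  exists f : X -> Y, continuous f /\ forall a x, A a x -> f x = g a x.
Proof.
move=> cA covA cg gE; have /choice [c cP] := covA.
exists (fun x => g (c x) x); split; last by move=> a x Ax; exact: gE.
apply/continuous_closedP => D cD.
rewrite (_ : _ @^-1` D = \bigcup_a (A a `&` g a @^-1` D)).
  apply: closed_bigcup; first exact: finite_finset.
  move=> a _; apply: closedI; first exact: cA.
  by apply: preimage_closed cD => x _; exact: cg.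
apply/seteqP; split=> [x Dx|x [a _ [Ax Dx]]]; first by exists (c x).
by rewrite /= (gE _ a).
Qed.

(** * Strata of a doubly indexed cover *)

Section staircase.
Context {X : topologicalType} {m n : nat}.
Context (P : 'I_m -> set X) (Q : 'I_m -> 'I_n -> set X).

Definition stratum (i : 'I_m) (j : 'I_n) : set X :=
  [set x | [/\ Q i j x, forall i' : 'I_m, (i' < i)%N -> ~ P i' x &
    forall j' : 'I_n, (j' < j)%N -> ~ Q i j' x]].

Lemma stratum_cover {x} : \bigcup_i P i = setT ->
  (forall i, P i `<=` \bigcup_j Q i j) -> exists i j, stratum i j x.
Proof.
move=> cP PQ; have [i0 _ Pi0] : (\bigcup_i P i) x by rewrite cP.
have /asboolT Pi0' := Pi0.
case: (arg_minnP (P := fun i => `[< P i x >]) val Pi0') => i /asboolP Pi mini.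
have [j0 _ /asboolT Qj0] := PQ i x Pi.
case: (arg_minnP (P := fun j => `[< Q i j x >]) val Qj0) => j /asboolP Qj minj.
exists i, j; split => // [i'|j']; rewrite ltnNge => /negP; apply: contra_not.
  by move=> /asboolT; exact: mini.
by move=> /asboolT; exact: minj.
Qed.

(** By symmetry [i < i'], and then [j' < j]. The stratum of [(i', j')] misses
    [P i] because [i'] is a first index; the stratum of [(i, j)] misses
    [Q i' j'] because a common point would lie in [Q i j'], while [j] is a first
    index. *)
Lemma separated_strata (i i' : 'I_m) (j j' : 'I_n) :
  (forall i, open (P i)) -> (forall i j, open (Q i j)) ->
  (forall i j, Q i j `<=` P i) ->
  (forall i i' j, P i `&` Q i' j `<=` Q i j) ->
  (i + j = i' + j')%N -> i != i' -> separated (stratum i j) (stratum i' j').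
Proof.
move=> oP oQ QP PQ.
wlog : i i' j j' / (i < i')%N.
  move=> wl ij ne; have [ii'|i'i|/val_inj e] := ltngtP i i'.
  - exact: wl ii' ij ne.
  - by rewrite separatedC; apply: wl i'i (esym ij) _; rewrite eq_sym.
  - by rewrite e eqxx in ne.
move=> ii' ij _.
have jj' : (j' < j)%N by rewrite -(ltn_add2l i') -ij ltn_add2r.
apply: (@separated_by_open _ _ _ (P i) (Q i' j')) => //.
- by move=> x [/QP].
- by move=> x [].
- by apply/seteqP; split => // x [Px [_ /(_ _ ii')]].
- apply/seteqP; split => // x [Qx [/QP Px _ /(_ _ jj') []]].
  exact: (PQ i i').
Qed.

End staircase.

(** * Planners from null-homotopies *)

Section null_homotopy.
Context {R : realType}.

Lemma clamp_subproof (r : R) :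
  (`|r| + 1 - `|r - 1|) / 2 \in (`[0, 1]%classic : set R).
Proof.
apply/mem_set; rewrite /= in_itv /=.
by have [r0|r0] := ger0P r; have [r1|r1] := ger0P (r - 1); lra.
Qed.

(** The retraction [min (max r 0) 1] of the line onto the unit interval, written
    with absolute values. *)
Definition clamp (r : R) : unit_interval R :=
  exist _ ((`|r| + 1 - `|r - 1|) / 2) (clamp_subproof r).

Lemma unit_interval_itv (t : unit_interval R) : 0 <= \val t <= 1.
Proof. by have := set_valP t; rewrite /= in_itv. Qed.

Lemma clamp_val (t : unit_interval R) : clamp (\val t) = t.
Proof.
apply: val_inj; rewrite [LHS]/=; have /andP[t0 t1] := unit_interval_itv t.
by have [r0|r0] := ger0P (\val t); have [r1|r1] := ger0P (\val t - 1); lra.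
Qed.

Lemma clamp0 : clamp 0 = unit0.
Proof. exact: (clamp_val unit0). Qed.

Lemma clamp1 : clamp 1 = unit1.
Proof. exact: (clamp_val unit1). Qed.

Lemma clamp_continuous : continuous clamp.
Proof.
apply: (@continuous_comp_initial _ _ R set_val) => r.
apply: cvgM; last exact: cvg_cst.
apply: cvgB.
  by apply: cvgD; [exact: norm_continuous|exact: cvg_cst].
apply: (@continuous_comp R R R (fun r => r - 1) Num.norm).
  by apply: cvgB; [exact: cvg_id|exact: cvg_cst].
exact: norm_continuous.
Qed.

(** The [i]-th coordinate of the contraction is run at double speed, and
    followed by a path from its end point to [x0]. Both pieces are extended to
    the whole line by clamping the parameter, so that closed pasting applies. *)
Lemma homotopy_arms {k : nat} {X : topologicalType} {U : set (power k X)}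
    (x0 : X) :
  path_connected R X -> null_homotopic_incl R U ->
  exists arm : 'I_k -> set_type U * R -> X, forall i,
    [/\ continuous (arm i), forall w, arm i (w, 0) = \val w i &
      forall w, arm i (w, 1) = x0].
Proof.
move=> cX [H [c [cH HE]]].
suff armP : forall i : 'I_k, exists arm : set_type U * R -> X,
    [/\ continuous arm, forall w, arm (w, 0) = \val w i &
      forall w, arm (w, 1) = x0].
  by have [arm armE] := choice armP; exists arm.
move=> i.
have [a [a0 a1]] := cX (c i) x0.
pose A (b : bool) :=
  [set z : set_type U * R | if b then z.2 <= 2^-1 else 2^-1 <= z.2].
pose g (b : bool) (z : set_type U * R) : X :=
  if b then H (\val z.1, clamp (2 * z.2)) i else a (clamp (2 * z.2 - 1)).
have cdbl : continuous (fun z : set_type U * R => 2 * z.2).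
  move=> z; apply: cvgM; [exact: cvg_cst|exact: continuous_snd].
have [||||arm [carm armE]] := @closed_pasting bool _ _ A g.
- case.
    apply: (@preimage_closed _ _ snd [set r : R | r <= 2^-1]).
      by move=> z _; exact: continuous_snd.
    exact: closed_le.
  apply: (@preimage_closed _ _ snd [set r : R | 2^-1 <= r]).
    by move=> z _; exact: continuous_snd.
  exact: closed_ge.
- move=> z; have [zle|/ltW zge] := leP z.2 2^-1; first by exists true.
  by exists false.
- case; rewrite /g /=.
    have cHc : continuous (fun z : set_type U * R =>
        H (\val z.1, clamp (2 * z.2))).
      apply: (within_comp (U `*` setT)); last exact: cH.
        apply: continuous_pair => z.
          apply: continuous_comp; first exact: continuous_fst.
          exact: continuous_val.
        by apply: continuous_comp; [exact: cdbl|exact: clamp_continuous].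
      by move=> z; split => //; exact: set_valP.
    by move=> z; exact: (continuous_comp (cHc z) (continuous_coord i _)).
  have cc : continuous (fun z : set_type U * R => clamp (2 * z.2 - 1)).
    move=> z; apply: (@continuous_comp _ _ _
      (fun z : set_type U * R => 2 * z.2 - 1) clamp);
      last exact: clamp_continuous.
    by apply: cvgB; [exact: cdbl|exact: cvg_cst].
  by move=> z; exact: (continuous_comp (cc z) (@cts_fun _ _ a _)).
- have gE w v :
      A true (w, v) -> A false (w, v) -> g true (w, v) = g false (w, v).
    rewrite /A /= => v1 v2; have -> : v = 2^-1 by apply: le_anti; rewrite v1.
    rewrite /g /= mulfV ?pnatr_eq0// subrr clamp0 clamp1 a0.
    by have [_ ->] := HE (\val w) (set_valP w).
  by move=> [] [] [w v] // Aw A'w; [exact: gE|exact/esym/gE].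
exists arm; split => // w.
  rewrite (armE true)/A/g/= ?invr_ge0// mulr0 clamp0.
  by have [-> _] := HE (\val w) (set_valP w).
rewrite (armE false) /A/g/=; last by rewrite invf_le1 ?ler1n ?ltr0n.
by rewrite mulr1 (_ : 2 - 1 = 1) ?clamp1//; lra.
Qed.

(** The path passes the node [i] at the entry [i] of the tuple and follows the
    [i]-th arm on both sides of the node, as far as the middle of the adjacent
    subdivision intervals, where every arm has reached the common point. *)
Lemma null_homotopic_motion_planner (k : nat) (X : topologicalType)
    (U : set (power k X)) :
  (1 < k)%N -> path_connected R X -> null_homotopic_incl R U ->
  exists s : power k X -> path_space R X, motion_planner U s.
Proof.
case: k U => // k U k0 cX hU.
have [_ [c _]] := hU.
have [arm armP] := homotopy_arms (c ord0) cX hU.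
(* Distance from the node [i], scaled to be [1] at the midpoints. *)
pose d (i : 'I_k.+1) (r : R) : R := 2 * `|k%:R * r - i%:R|.
have cd i : continuous (d i).
  rewrite /d => r; apply: cvgM; first exact: cvg_cst.
  apply: (@continuous_comp _ R R (fun r : R => k%:R * r - i%:R) Num.norm);
    last exact: norm_continuous.
  apply: cvgB; last exact: cvg_cst.
  by apply: cvgM; [exact: cvg_cst|exact: cvg_id].
pose A i := [set z : set_type U * unit_interval R | d i (\val z.2) <= 1].
pose g i (z : set_type U * unit_interval R) := arm i (z.1, d i (\val z.2)).
have cd2 i :
    continuous (fun z : set_type U * unit_interval R => d i (\val z.2)).
  move=> z; apply: (@continuous_comp _ _ _
    (fun z : set_type U * unit_interval R => \val z.2) (d i)); last exact: cd.
  by apply: continuous_comp; [exact: continuous_snd|exact: continuous_val].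
have [||||h [ch hE]] := @closed_pasting 'I_k.+1 _ _ A g.
- move=> i; apply: (@preimage_closed (set_type U * unit_interval R)%type R
    (fun z => d i (\val z.2)) [set r : R | r <= 1]).
    by move=> z _; exact: cd2.
  exact: closed_le.
- move=> [w t]; have /andP[t0 t1] := unit_interval_itv t.
  suff [i ki] : exists i : 'I_k.+1, d i (\val t) <= 1 by exists i.
  rewrite /d; set x : R := k%:R * \val t.
  have x0 : 0 <= x by rewrite mulr_ge0.
  have xk : x <= k%:R by rewrite ler_piMr.
  (* The nearest integer to [x] is the truncation of [x + 1/2]. *)
  have y0 : 0 <= x + 2^-1 by lra.
  have /andP[le_y lt_y] := truncn_itv y0.
  set j := Num.truncn _ in le_y lt_y.
  have jk : (j < k.+1)%N.
    by rewrite -(ltr_nat R) -(natr1 k); apply: (le_lt_trans le_y); lra.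
  exists (Ordinal jk); rewrite -(natr1 j) in lt_y.
  by rewrite [nat_of_ord _]/=; have [|] := ger0P (x - j%:R); lra.
- move=> i z; have [carm _ _] := armP i.
  have cp : continuous (fun z : set_type U * unit_interval R =>
      (z.1, d i (\val z.2))).
    by apply: continuous_pair; [exact: continuous_fst|exact: cd2].
  exact: (continuous_comp (cp z) (carm _)).
- move=> i j [w t]; rewrite /A /g /=.
  have [->//|ij] := eqVneq i j.
  (* Two cells meet only at a midpoint, since distinct nodes are at distance at
     least 1 on the scale of [x]. *)
  move=> di dj; have [di1 dj1] : d i (\val t) = 1 /\ d j (\val t) = 1.
    move: di dj; rewrite /d; set x := k%:R * \val t.
    have : 1 <= `|i%:R - j%:R| :> R.
      wlog lt_ij : i j ij / (i < j)%N.
        move=> wl; have [lt|gt|/val_inj e] := ltngtP i j.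
        - exact: wl.
        - by rewrite distrC; apply: wl => //; rewrite eq_sym.
        - by rewrite e eqxx in ij.
      rewrite distrC ger0_norm ?subr_ge0 ?ler_nat 1?ltnW//.
      by rewrite lerBrDr addrC natr1 ler_nat.
    have := ler_distD x i%:R j%:R.
    by rewrite (distrC i%:R x) => ? ? ? ?; split; lra.
  have [_ _ Ei] := armP i; have [_ _ Ej] := armP j.
  by rewrite di1 dj1 Ei Ej.
apply: (motion_plannerP h) => // w i.
have di : d i (\val (node R i)) = 0.
  rewrite /d /= mulrCA divff ?mulr1 ?subrr ?normr0 ?mulr0//.
  by rewrite pnatr_eq0 -lt0n.
rewrite (hE i) /A /g /= di ?ler01//.
by have [_ -> _] := armP i.
Qed.

End null_homotopy.

(** * Least cardinals of open covers *)

Section cover_numbers.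
Context {R : realType} {Y : topologicalType}.

Lemma open_cover_number_le {P : set Y -> Prop} {n : nat}
    (W : 'I_n -> set Y) :
  (forall i, open (W i)) -> \bigcup_i W i = setT -> (forall i, P (W i)) ->
  (@open_cover_number R Y P <= n%:R%:E)%E.
Proof.
by move=> oW cW PW; apply: ereal_inf_lbound; exists n => //; exists W.
Qed.

Lemma open_cover_number_ge (P : set Y -> Prop) (x : \bar R) :
  (forall n (W : 'I_n -> set Y), (forall i, open (W i)) ->
    \bigcup_i W i = setT -> (forall i, P (W i)) -> (x <= n%:R%:E)%E) ->
  (x <= open_cover_number R P)%E.
Proof.
by move=> xP; apply: le_ereal_inf_tmp => _ [n [W [oW cW PW]] <-]; exact: xP PW.
Qed.

Lemma le_open_cover_number (P Q : set Y -> Prop) :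
  (forall W, Q W -> P W) ->
  (open_cover_number R P <= open_cover_number R Q)%E.
Proof.
move=> QP; apply: open_cover_number_ge => n W oW cW QW.
by apply: open_cover_number_le oW cW _ => i; exact: QP.
Qed.

End cover_numbers.

(** * Planners in a trivialized part of the bundle *)

Section trivialized_planners.
Context {R : realType} {k : nat} {E B F : topologicalType} {p : E -> B}.

Definition base_coord (e : power k E) : power k B := fun l => p (e l).

Definition fibre_coord {C : set B} (f : local_trivialization F p C)
  (e : power k E) : power k F := fun l => (triv f (e l)).2.

Context (cp : continuous p).

Lemma base_coord_continuous : continuous base_coord.
Proof.
apply: continuous_power => i e.
exact: (continuous_comp (continuous_coord i e) (cp _)).
Qed.

Context {C : set B} (f : local_trivialization F p C) {U : set (power k B)}.
Context (UC : forall x, U x -> forall l, C (x l)).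

Lemma fibre_coord_continuous :
  {within base_coord @^-1` U, continuous (fibre_coord f)}.
Proof.
apply/subspace_sigL_continuousP; apply: continuous_power => l.
have ct : continuous (fun e : set_type (base_coord @^-1` U) =>
    triv f ((\val e : power k E) l)).
  have cl : continuous (fun e : set_type (base_coord @^-1` U) =>
      (\val e : power k E) l).
    by move=> e; exact: (continuous_comp (continuous_val e)
      (continuous_coord l _)).
  apply: (within_comp (p @^-1` C) cl); last first.
    exact: triv_continuous.
  by move=> e; exact: (UC _ (set_valP e)).
by move=> e; exact: (continuous_comp (ct e) (continuous_snd _)).
Qed.

(** The trivialization is continuous only for the subspace topology over [C];
    over the open set [U] this is continuity in the usual sense. *)
Lemma trivialized_open (V : set (power k F)) :
  open U -> open V ->
  open (base_coord @^-1` U `&` fibre_coord f @^-1` V).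
Proof.
move=> oU oV; have oP : open (base_coord @^-1` U).
  by apply: open_comp oU => e _; exact: base_coord_continuous.
apply: (iffLR (continuous_inP (fibre_coord f) oP)) => //.
by rewrite -continuous_open_subspace//; exact: fibre_coord_continuous.
Qed.

(** The path in the base and the path in the fibre form a path in [C * F], where
    the inverse of the trivialization is continuous. *)
Lemma trivialized_motion_planner {V : set (power k F)}
    {s : power k B -> path_space R B} {r : power k F -> path_space R F} :
  (0 < k)%N -> motion_planner U s -> (forall x, U x -> forall t, C (s x t)) ->
  motion_planner V r ->
  exists w : power k E -> path_space R E,
    motion_planner (base_coord @^-1` U `&` fibre_coord f @^-1` V) w.
Proof.
move=> k0 [cs sU] sC [cr rV].
set W := _ `&` _.
have WU (e : set_type W) : U (base_coord (\val e)) by case: (set_valP e).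
have WV (e : set_type W) : V (fibre_coord f (\val e)) by case: (set_valP e).
pose h (z : set_type W * unit_interval R) : E :=
  triv_inv f (s (base_coord (\val z.1)) z.2, r (fibre_coord f (\val z.1)) z.2).
apply: (motion_plannerP h) => //; last first.
  move=> e i; rewrite /h /=.
  have /(congr1 (fun x : power k B => x i)) := sU _ (WU e).
  have /(congr1 (fun x : power k F => x i)) := rV _ (WV e).
  rewrite /path_eval => -> ->; have Ce : C (p ((\val e : power k E) i)).
    exact: (UC _ (WU e) i).
  rewrite /base_coord /fibre_coord -(triv_over f)// -surjective_pairing.
  exact: trivK.
apply: (@within_comp _ _ _ (C `*` setT)
  (fun z : set_type W * unit_interval R => (s (base_coord (\val z.1)) z.2,
    r (fibre_coord f (\val z.1)) z.2)) (triv_inv f)).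
- apply: continuous_pair.
    apply: (iffLR (path_space_continuousP
      (fun e : set_type W => s (base_coord (\val e))))).
    apply: (@within_comp _ _ _ U
      (fun e : set_type W => base_coord (\val e)) s) => //.
    move=> e; apply: (continuous_comp (continuous_val e)).
    exact: base_coord_continuous.
  apply: (iffLR (path_space_continuousP
    (fun e : set_type W => r (fibre_coord f (\val e))))).
  apply: (@within_comp _ _ _ V
    (fun e : set_type W => fibre_coord f (\val e)) r) => //.
  apply: (@within_comp _ _ _ (base_coord @^-1` U)
    (fun e : set_type W => \val e) (fibre_coord f)) => //.
    exact: continuous_val.
  exact: fibre_coord_continuous.
- by move=> z; split => //; exact: (sC _ (WU z.1)).
- exact: triv_inv_continuous.
Qed.

End trivialized_planners.
Arguments base_coord {k E B} p e.
Arguments fibre_coord {k E B F p C} f e.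

(** The transition functions are applied entry by entry, at [k] different points
    of the base; hence an element of [G^k], and not of [G], relates the two
    fibre coordinates. *)
Lemma transition_fibre_coord {G : topologicalGroupType} {k : nat}
    {E B F : topologicalType} {act : G -> F -> F} {p : E -> B} {J : Type}
    {C : J -> set B} {f : forall j, local_trivialization F p (C j)} :
  G_atlas act f ->
  forall i j (e : power k E),
    (forall l, C i (p (e l))) -> (forall l, C j (p (e l))) ->
    exists g : {ffun 'I_k -> G},
      fibre_coord (f i) e = power_act act g (fibre_coord (f j) e).
Proof.
move=> [t tP] i j e Ci Cj; exists [ffun l => t i j (p (e l))].
apply/funext => l; rewrite /fibre_coord /power_act ffunE.
have [_ /(_ (p (e l)) (triv (f j) (e l)).2 (conj (Ci l) (Cj l)))] := tP i j.
by rewrite -[X in (X, _)](triv_over (f j))// -surjective_pairing trivK// => ->.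
Qed.

(** * The combined cover *)

Section fibrewise_cover.
Context {R : realType} {G : topologicalGroupType}
    {E B F : topologicalType} {act : G -> F -> F} {p : E -> B} {k m : nat}
    {U : 'I_m -> set (power k B)} {s : 'I_m -> power k B -> path_space R B}
    {C : 'I_m -> set B} {f : forall i, local_trivialization F p (C i)}.
Context (k0 : (0 < k)%N) (cp : continuous p)
  (nE : completely_normal (power k E)) (oU : forall i, open (U i))
  (cU : \bigcup_i U i = setT) (sU : forall i, motion_planner (U i) (s i))
  (fG : G_atlas act f) (sC : forall i x, U i x -> forall t, C i (s i x t)).

Lemma planner_domain_sub i x : U i x -> forall l, C i (x l).
Proof.
move=> Ux l; have [_ /(_ x Ux) /(congr1 (fun y : power k B => y l)) <-] := sU i.
exact: sC.
Qed.

(** The level [l] of the new cover is the union of the shrunken [Q i j] with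
    [i + j = l]. The levels run from [0] to [(m - 1) + (n - 1)], so there are
    [m + n - 1] of them. *)
Lemma TC_le_cover {n : nat} (V : 'I_n -> set (power k F)) :
  (forall j, open (V j)) -> \bigcup_j V j = setT ->
  (forall j, invariant_set (@power_act G F k act) (V j)) ->
  (forall j, exists r : power k F -> path_space R F, motion_planner (V j) r) ->
  (TC R k E <= (m + n).-1%:R%:E)%E.
Proof.
move=> oV cV iV rV.
pose P i := base_coord p @^-1` U i.
pose Q i j := P i `&` fibre_coord (f i) @^-1` V j.
have PC i e : P i e -> forall l, C i (p (e l)) by exact: planner_domain_sub.
have oQ i j : open (Q i j).
  by apply: trivialized_open => //; exact: planner_domain_sub.
have oP i : open (P i).
  by apply: open_comp (oU i) => e _; exact: base_coord_continuous.
have cP : \bigcup_i P i = setT.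
  apply/seteqP; split=> // e _.
  have [i _ Ui] : (\bigcup_i U i) (base_coord p e) by rewrite cU.
  by exists i.
have PQ i : P i `<=` \bigcup_j Q i j.
  move=> e Pe; have [j _ Vj] : (\bigcup_j V j) (fibre_coord (f i) e).
    by rewrite cV.
  by exists j.
have QQ i i' j : P i `&` Q i' j `<=` Q i j.
  move=> e [Pe [P'e Ve]]; split=> //=.
  have [g ->] := transition_fibre_coord fG i i' e
    (PC _ _ Pe) (PC _ _ P'e).
  exact: iV.
pose Z (a : 'I_m * 'I_n) := stratum P Q a.1 a.2.
have [|O [oO ZO O0]] := separated_family_open
  (fun a b : 'I_m * 'I_n => a.1 + a.2 = b.1 + b.2 /\ a <> b)%N (Z := Z) nE.
  move=> [i j] [i' j'] /= [ij ne]; apply: separated_strata => //.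
    by move=> i1 j1 e [].
  apply/eqP => /= ii'; apply: ne; rewrite -ii' in ij *; congr (_, _).
  exact/val_inj/(addnI ij).
(* The neighbourhood [O a] is cut down to the set where a planner exists. *)
pose W (a : 'I_m * 'I_n) := O a `&` Q a.1 a.2.
pose D (l : nat) := [set a : 'I_m * 'I_n | (a.1 + a.2 = l)%N].
have oW a : open (W a) by exact: openI.
apply: (open_cover_number_le
  (fun l : 'I_(m + n).-1 => \bigcup_(a in D l) W a)).
- by move=> l; apply: bigcup_open => a _; exact: oW.
- apply/seteqP; split=> // e _.
  have [i [j Ze]] := stratum_cover P Q (x := e) cP PQ.
  have lt_ij : (i + j < (m + n).-1)%N.
    by rewrite -subn1 ltn_subRL add1n -addSn -addnS leq_add// ltn_ord.
  exists (Ordinal lt_ij) => //; exists (i, j) => //; split; first exact: ZO.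
  by case: Ze.
- move=> l; apply: motion_planner_bigcup => //.
  + move=> a b Da Db [e [[Oa _] [Ob _]]]; apply: contrapT => ab.
    by have : (O a `&` O b) e by []; rewrite O0//; split=> //; rewrite Da Db.
  + move=> a _; have [r rP] := rV a.2.
    have [w wP] := trivialized_motion_planner cp (f a.1)
      (planner_domain_sub a.1) k0 (sU a.1) (sC a.1) rP.
    by exists w; apply: motion_plannerW wP => e [].
Qed.

End fibrewise_cover.

Theorem theorem1p1 (R : realType) (G : topologicalGroupType)
    (E B F : topologicalType) (act : G -> F -> F) (p : E -> B) (k m : nat)
    (U : 'I_m -> set (power k B)) (s : 'I_m -> power k B -> path_space R B)
    (C : 'I_m -> set B) (f : forall i, local_trivialization F p (C i)) :
  (2 <= k)%N -> (1 <= m)%N ->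
  continuous_action act ->
  fibre_bundle act p ->
  completely_normal (power k E) ->
  (forall i, open (U i)) ->
  \bigcup_i U i = setT ->
  (forall i, motion_planner (U i) (s i)) ->
  (forall i, closed (C i)) ->
  \bigcup_i C i = setT ->
  G_atlas act f ->
  (forall i x, U i x -> forall t, C i (s i x t)) ->
  [/\ (TC R k E <= m%:R%:E + TC_sharp_star R k act - 1)%E,
      path_connected R F ->
      (TC R k E <= m%:R%:E + cat_sharp R (@power_act G F k act) - 1)%E
    & (TC R k E <= m%:R%:E + TC_star R k act - 1)%E].
Proof.
move=> k2 m1 _ [cp _] nE oU cU sU _ _ fG sC.
have k0 : (0 < k)%N by exact: ltnW.
have TCE : (TC R k E <= m%:R%:E + TC_sharp_star R k act - 1)%E.
  rewrite addeAC addeC -leeBlDr//; apply: open_cover_number_ge => n V oV cV.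
  move=> /all_and2 [iV rV]; rewrite leeBlDr//.
  have := TC_le_cover k0 cp nE oU cU sU fG sC V oV cV iV rV.
  move=> /le_trans; apply; rewrite -EFinB -EFinD lee_fin.
  by rewrite -subn1 natrB ?addn_gt0 ?m1// natrD; lra.
have leTC x : (TC_sharp_star R k act <= x)%E ->
    (TC R k E <= m%:R%:E + x - 1)%E.
  by move=> TCx; apply: le_trans TCE _; rewrite leeD2r// leeD2l.
split=> // [cF|]; apply: leTC; apply: le_open_cover_number => W [iW].
  by move=> hW; split=> //; exact: null_homotopic_motion_planner.
by move=> [r [rP _]]; split=> //; exists r.
Qed.
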